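(* Let $G$ be a finite group, let $G_1,\ldots,G_n$ be subgroups of $G$, let $C$ be the quasi-uniform code obtained from $G$ and $G_1,\ldots,G_n$, and let $G_{\mathcal{N}}=\bigcap_{i=1}^n G_i$. Then $|C|=|G|/|G_{\mathcal{N}}|$. In particular, if $|G_{\mathcal{N}}|=1$, then $|C|=|G|$.
   Context: Let $n\ge 1$ and $\mathcal{N}=\{1,\ldots,n\}$. For a finite group $G$ with subgroups $G_1,\ldots,G_n$, the quasi-uniform code of length $n$ obtained from $G$ and $G_1,\ldots,G_n$ is the set of words $C=\{(gG_1,\ldots,gG_n) : g\in G\}$, where $gG_i=\{gh : h\in G_i\}$ is a left coset. As a set, $C$ counts each distinct word once. *)

(* Defs.v *)
From mathcomp Require Import all_boot all_order all_algebra all_fingroup.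

Set Implicit Arguments.
Unset Strict Implicit.
Unset Printing Implicit Defensive.

Local Open Scope group_scope.

(* Positions 1, ..., n are indexed by 'I_n; a word is a finite function giving
   the left coset at each position.  As an image set, it contains each distinct
   word once. *)
Definition qu_code (gT : finGroupType) (n : nat) (G : {group gT})
    (Gs : 'I_n -> {group gT}) : {set {ffun 'I_n -> {set gT}}} :=
  [set [ffun i : 'I_n => g *: Gs i] | g in G].

Definition inter_subgroups (gT : finGroupType) (n : nat)
    (Gs : 'I_n -> {group gT}) : {set gT} :=
  \bigcap_(i < n) Gs i.

(* Main.v *)
Require Import Defs.
From mathcomp Require Import all_boot all_order all_algebra all_fingroup.

(** Two elements g, h of G give the same word iff h^-1 * g lies in every G_i,
    that is, iff g and h lie in the same left coset of the intersection H of
    the G_i.  Hence A |-> (A G_1, ..., A G_n) is a bijection from the left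
    cosets of H in G onto the code ([card_qu_code]), and Lagrange's theorem
    gives |C| = |G| / |H|. *)

Lemma mem_inter_subgroups (gT : finGroupType) (n : nat)
    (Gs : 'I_n -> {group gT}) (x : gT) :
  reflect (forall i, x \in Gs i) (x \in inter_subgroups Gs).
Proof.
apply: (iffP bigcapP) => [xGs i | xGs i _]; last exact: xGs.
exact: xGs.
Qed.

Lemma card_qu_code (gT : finGroupType) (G : {group gT}) (n : nat)
    (Gs : 'I_n -> {group gT}) :
  #|qu_code G Gs| = #|G : inter_subgroups Gs|%g.
Proof.
pose H := (\bigcap_(i < n) Gs i)%G.
have -> : inter_subgroups Gs = H by [].
pose word (A : {set gT}) := [ffun i : 'I_n => (A * Gs i)%g].
have wordE g : word (g *: H)%g = [ffun i : 'I_n => (g *: Gs i)%g].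
  apply/ffunP => i; rewrite !ffunE -!mulgA.
  by rewrite mulSGid // bigcap_inf.
have -> : qu_code G Gs = [set word A | A in lcosets H G].
  rewrite /lcosets -imset_comp.
  by apply: eq_imset => g; rewrite /= -wordE lcosetE.
rewrite card_in_imset ?card_lcosets //.
move=> _ _ /lcosetsP[g _ ->] /lcosetsP[h _ ->].
rewrite !wordE => /ffunP eq_gh; apply/lcoset_eqP; rewrite mem_lcoset.
apply/mem_inter_subgroups => i.
have := eq_gh i; rewrite !ffunE => /lcoset_eqP.
by rewrite mem_lcoset.
Qed.

Theorem lemma1 (gT : finGroupType) (G : {group gT}) (n : nat) (hn : (1 <= n)%N)
    (Gs : 'I_n -> {group gT}) (hGs : forall i : 'I_n, Gs i \subset G) :
  ((#|qu_code G Gs|%:R : rat) = #|G|%:R / #|inter_subgroups Gs|%:R)%R /\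
  (#|inter_subgroups Gs| = 1%N -> #|qu_code G Gs| = #|G|).
Proof.
have sHG : inter_subgroups Gs \subset G.
  (* The empty intersection would be all of gT: this is where 1 <= n is used. *)
  apply/subsetP => x /mem_inter_subgroups xGs.
  exact: (subsetP (hGs (Ordinal hn))).
have lagrange : (#|inter_subgroups Gs| * #|qu_code G Gs|)%N = #|G|.
  rewrite card_qu_code.
  exact: (@Lagrange _ G (\bigcap_(i < n) Gs i)%G).
split; last by move=> H1; rewrite -lagrange H1 mul1n.
have H_neq0 : (#|inter_subgroups Gs|%:R != 0 :> rat)%R.
  by rewrite Num.Theory.pnatr_eq0 -lt0n (cardG_gt0 (\bigcap_(i < n) Gs i)%G).
by rewrite -lagrange mulnC GRing.natrM GRing.mulfK.
Qed.
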